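(* Let $\mathbb{V}$ be a real topological vector space, $\mathbb{K}\subset\mathbb{V}$ a (closed, convex) topologically normal cone with non-empty interior, with induced partial order $\preceq$, and let $\mathbf{e}\in\mathrm{int}(\mathbb{K})$ with associated gauge norm $\|\cdot\|_{\mathbf{e}}$. Let $\theta^*\in\mathbb{V}$, $\nu\in(0,1)$, and let $\{\mathcal{H}_k\}_{k\ge 1}$ be operators $\mathcal{H}_k:\mathbb{V}\to\mathbb{V}$ such that for every $k\geq 1$: $\mathcal{H}_k(\theta)\preceq\mathcal{H}_k(\theta')$ whenever $\theta\preceq\theta'$, and $\|\mathcal{H}_k(\theta)-\mathcal{H}_k(\theta^* )\|_{\mathbf{e}}\le \nu\|\theta-\theta^*\|_{\mathbf{e}}$ for all $\theta\in\mathbb{V}$. Let $\{E_k\}_{k\ge1}$ be an arbitrary sequence in $\mathbb{V}$, $\theta_1\in\mathbb{V}$ arbitrary, $\omega\in(0,1)$, and take the stepsizes $\lambda_k=1/k^{\omega}$, $k\ge1$. Let $\theta_{k+1}=(1-\lambda_k)\theta_k+\lambda_k\{\mathcal{H}_k(\theta_k)+E_k\}$ for $k\ge1$. Define $W_k=\mathcal{H}_k(\theta^* )-\theta^*+E_k$, $P_1=0$ and $P_{k}=(1-\lambda_{k-1})P_{k-1}+\lambda_{k-1}W_{k-1}$ for $k\ge2$. Then for all $k=1,2,\ldots$, $$\|\theta_{k+1}-\theta^*\|_{\mathbf{e}}\le e^{-\frac{1-\nu}{1-\omega}(k^{1-\omega}-1)}\|\theta_1-\theta^*\|_{\mathbf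{e}}+e^{-\frac{1-\nu}{1-\omega}k^{1-\omega}}\sum_{\ell=1}^k\frac{e^{\frac{1-\nu}{1-\omega}\ell^{1-\omega}}}{\ell^\omega}\|P_\ell\|_{\mathbf{e}}+\|P_{k+1}\|_{\mathbf{e}}.$$
   Context: The cone $\mathbb{K}$ induces the partial order $\theta\preceq\theta'\iff\theta'-\theta\in\mathbb{K}$ on $\mathbb{V}$. For $\mathbf{e}\in\mathrm{int}(\mathbb{K})$, the order interval is $[-\mathbf{e},\mathbf{e}]=\{\theta\in\mathbb{V}\mid-\mathbf{e}\preceq\theta\preceq\mathbf{e}\}$ and the associated gauge (Minkowski) norm is $\|\theta\|_{\mathbf{e}}=\inf\{s>0\mid\theta/s\in[-\mathbf{e},\mathbf{e}]\}$. Topologically normal means that $\mathbb{V}$ has a base of neighbourhoods $U$ of $0$ that are full, i.e. $x\preceq z\preceq y$ with $x,y\in U$ implies $z\in U$. It is not required that $\theta^*$ be a fixed point of each $\mathcal{H}_k$. *)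

(* Defs.v *)
From mathcomp Require Import all_boot all_order all_algebra.
From mathcomp Require Import all_classical all_reals all_analysis.

Set Implicit Arguments.
Unset Strict Implicit.
Unset Printing Implicit Defensive.

Import Order.TTheory GRing.Theory Num.Theory.

Local Open Scope classical_set_scope.
Local Open Scope ring_scope.

(* The ambient space is a [topologicalLmodType R], not a [tvsType R]: the
   latter is locally convex, which a topological vector space need not be. *)

(* Pointedness is what makes the induced order [cone_le] antisymmetric. *)
Definition closed_convex_cone (R : realType) (V : topologicalLmodType R)
    (K : set V) : Prop :=
  [/\ closed K,
      convex_set K,
      (forall (a : R) (x : V), 0 <= a -> K x -> K (a *: x)) &
      (forall x : V, K x -> K (- x) -> x = 0)].

Definition cone_le (R : realType) (V : topologicalLmodType R) (K : set V)
    (x y : V) : Prop := K (y - x).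

Definition full_set (R : realType) (V : topologicalLmodType R) (K : set V)
    (U : set V) : Prop :=
  forall x y z : V, U x -> U y -> cone_le K x z -> cone_le K z y -> U z.

Definition topologically_normal (R : realType) (V : topologicalLmodType R)
    (K : set V) : Prop :=
  exists B : set_system V,
    [/\ (forall U, B U -> nbhs (0 : V) U),
        (forall A, nbhs (0 : V) A -> exists2 U, B U & U `<=` A) &
        (forall U, B U -> full_set K U)].

Definition order_interval (R : realType) (V : topologicalLmodType R)
    (K : set V) (a b : V) : set V :=
  [set x | cone_le K a x /\ cone_le K x b].

Definition gauge_norm (R : realType) (V : topologicalLmodType R) (K : set V)
    (e x : V) : R :=
  inf [set s : R | 0 < s /\ order_interval K (- e) e (s^-1 *: x)].

(* Main.v *)
Require Import Defs.
From mathcomp Require Import all_boot all_order all_algebra.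
From mathcomp Require Import all_classical all_reals all_analysis.
From mathcomp Require Import ring lra.

(** Put z_k = theta_k - theta^* - P_k.  Subtracting P_k removes the noise:
    z_(k+1) = (1 - lambda_k) z_k + lambda_k (H_k theta_k - H_k theta^* ), so with
    a = 1 - nu the triangle inequality gives
    |z_(k+1)| <= (1 - a lambda_k) |z_k| + nu lambda_k |P_k|.
    Since 1 - t <= exp(-t), unrolling bounds |z_(k+1)| by exp(-a S_k) times
    |z_1| + nu sum_l exp(a S_l) lambda_l |P_l|, where S_k is the sum of the
    lambda_j with j <= k.  Let g(k) = k^(1-omega) / (1-omega).  By concavity
    S_(k-1) - g(k) is nondecreasing in k, so S_k - S_l >= g(k) - g(l) - 1, and the
    factor exp(a) lost to the -1 is compensated by nu, as nu exp(1 - nu) <= 1. *)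

Set Implicit Arguments.
Unset Strict Implicit.
Unset Printing Implicit Defensive.

Import Order.TTheory GRing.Theory Num.Theory.

Local Open Scope classical_set_scope.
Local Open Scope ring_scope.

Section GaugeNorm.
Context (R : realType) (V : topologicalLmodType R) (K : set V) (e : V).
Hypotheses (hK : closed_convex_cone K) (he : interior K e).

Let cone_scale (a : R) x : 0 <= a -> K x -> K (a *: x).
Proof. by move=> a0 Kx; case: hK => _ _ + _; apply. Qed.

Let cone_unit : K e.
Proof. exact: nbhs_singleton he. Qed.

(** Convexity puts the midpoint in [K], and scaling by 2 turns it into the sum. *)
Lemma cone_add x y : K x -> K y -> K (x + y).
Proof.
move=> Kx Ky; case: hK => _ cvxK _ _.
have half0 : 0 <= 2^-1 :> R by lra.
have half1 : 2^-1 <= 1 :> R by lra.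
have := cvxK x y (Itv01 half0 half1) (mem_set Kx) (mem_set Ky).
rewrite inE => /(cone_scale (ler0n R 2)).
rewrite -[conv _ _ _]/(2^-1 *: x + (1 - 2^-1) *: y) scalerDr !scalerA mulrBr mulr1 mulfV ?pnatr_eq0//.
by rewrite (_ : 2 - 1 = 1 :> R) ?scale1r//; lra.
Qed.

(** Clearing the division by [s] leaves two cone conditions linear in [s] and [x], which can be
    added and scaled. *)
Lemma order_interval_scaled (s : R) x : 0 < s ->
  order_interval K (- e) e (s^-1 *: x) <-> K (s *: e + x) /\ K (s *: e - x).
Proof.
move=> s0; have s_neq0 : s != 0 by rewrite gt_eqF.
have scaleE z : s *: (s^-1 *: z) = z by rewrite scalerA divff// scale1r.
have scaleVE z : s^-1 *: (s *: z) = z by rewrite scalerA mulVf// scale1r.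
rewrite /order_interval /cone_le /= opprK; split => -[K1 K2]; split.
- by rewrite -[x]scaleE -scalerDr; apply: cone_scale; rewrite 1?addrC// ltW.
- by rewrite -[x]scaleE -scalerBr; apply: cone_scale; rewrite // ltW.
- by rewrite -[e]scaleVE -scalerDr; apply: cone_scale; rewrite 1?addrC// invr_ge0 ltW.
- by rewrite -[e]scaleVE -scalerBr; apply: cone_scale; rewrite // invr_ge0 ltW.
Qed.

(** As [e] is interior, continuity of the vector operations keeps both [e + t *: x] and [e - t *: x]
    in [K] for small [t]; then [t^-1] is admissible. Without this the [inf] could be a mere default
    value. *)
Lemma gauge_set_nonempty x :
  [set s : R | 0 < s /\ order_interval K (- e) e (s^-1 *: x)] !=set0.
Proof.
have line_cvg (y : V) : (fun t : R^o => e + t *: y) @ (0 : R^o) --> e.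
  have scale_cvg : (fun t : R^o => t *: y) @ (0 : R^o) --> (0 : R^o) *: y.
    apply: (cvg_comp2 (f := fun t : R^o => t) (g := fun=> y)
      (h := fun (a : R^o) (b : V) => a *: b) cvg_id (cvg_cst y)).
    exact: (@scale_continuous R V ((0 : R^o), y)).
  rewrite -[X in _ --> X]addr0 -(scale0r y).
  apply: (cvg_comp2 (f := fun=> e) (g := fun t : R^o => t *: y)
    (h := fun a b : V => a + b) (cvg_cst e) scale_cvg).
  exact: (@add_continuous V (e, (0 : R^o) *: y)).
have near_K (y : V) : \forall t \near (0 : R^o), K (e + t *: y).
  exact: (line_cvg y _ he).
have /nbhs_ballP[r /= r0 rK] : \forall t \near (0 : R^o),
    K (e + t *: x) /\ K (e + t *: (- x)).
  by apply: filterI; exact: near_K.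
have [] := rK (r / 2).
  rewrite /ball /= sub0r normrN gtr0_norm ?divr_gt0//.
  by rewrite ltr_pdivrMr// mulr_natr mulr2n ltrDl.
rewrite scalerN => K1 K2; exists (r / 2)^-1; split.
  by rewrite invr_gt0 divr_gt0.
by rewrite invrK; split => //; rewrite /cone_le opprK addrC.
Qed.

Let gauge_set_has_inf x :
  has_inf [set s : R | 0 < s /\ order_interval K (- e) e (s^-1 *: x)].
Proof.
by split; [exact: gauge_set_nonempty|exists 0 => s [/ltW]].
Qed.

Lemma gauge_norm_ge0 x : 0 <= gauge_norm K e x.
Proof. by apply: lb_le_inf; [exact: gauge_set_nonempty|move=> s [/ltW]]. Qed.

(** If [s] and [t] are nearly optimal for [x] and [y], then [a * s + b * t], slightly enlarged, is
    admissible for the combination. *)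
Lemma gauge_norm_sublinear (a b : R) x y : 0 <= a -> 0 <= b ->
  gauge_norm K e (a *: x + b *: y) <=
  a * gauge_norm K e x + b * gauge_norm K e y.
Proof.
move=> a0 b0; apply/ler_addgt0Pr => eps eps0.
(* The errors are [a * d] and [b * d] from the two infima, plus one [d] that keeps the scale
   positive even when [a = b = 0]; they total [eps]. *)
set d := eps / (a + b + 1).
have ab1 : 0 < a + b + 1 by rewrite ltr_wpDl// addr_ge0.
have d0 : 0 < d by rewrite divr_gt0.
have [s [s0 /(order_interval_scaled _ s0)[sx1 sx2]] sltx] :=
  inf_adherent d0 (gauge_set_has_inf x).
have [t [t0 /(order_interval_scaled _ t0)[ty1 ty2]] tlty] :=
  inf_adherent d0 (gauge_set_has_inf y).
have r0 : 0 < a * s + b * t + d.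
  by rewrite ltr_wpDl// addr_ge0// mulr_ge0// ltW.
apply: (@le_trans _ _ (a * s + b * t + d)).
  apply: ge_inf; first by exists 0 => ? [/ltW].
  split => //; apply/order_interval_scaled => //.
  have Kde : K (d *: e) by apply: cone_scale => //; exact: ltW.
  split.
  - have -> : (a * s + b * t + d) *: e + (a *: x + b *: y) =
        a *: (s *: e + x) + b *: (t *: e + y) + d *: e.
      rewrite !scalerDr !scalerDl !scalerA addrAC; congr (_ + _).
      by rewrite addrACA.
    by apply: cone_add => //; apply: cone_add; exact: cone_scale.
  - have -> : (a * s + b * t + d) *: e - (a *: x + b *: y) =
        a *: (s *: e - x) + b *: (t *: e - y) + d *: e.
      rewrite !scalerDr !scalerDl !scalerA addrAC; congr (_ + _).
      by rewrite opprD -!scalerN addrACA.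
    by apply: cone_add => //; apply: cone_add; exact: cone_scale.
have dE : d * (a + b + 1) = eps by rewrite divfK// gt_eqF.
have as_le : a * s <= a * (gauge_norm K e x + d).
  by rewrite ler_wpM2l// ltW.
have bt_le : b * t <= b * (gauge_norm K e y + d).
  by rewrite ler_wpM2l// ltW.
by rewrite -dE; lra.
Qed.

Lemma gauge_norm_triangle x y :
  gauge_norm K e (x + y) <= gauge_norm K e x + gauge_norm K e y.
Proof.
by have := @gauge_norm_sublinear 1 1 x y ler01 ler01; rewrite !scale1r !mul1r.
Qed.

End GaugeNorm.

Section PowerIncrement.
Context (R : realType).

(* Combine the tangent bounds [1 + v <= expR v] at [v = (1 - p) u] and
   [v = - p u] with weights [p] and [1 - p]. *)
Lemma expR_weighted_le (p u : R) : 0 <= p -> p <= 1 ->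
  expR (p * u) <= 1 - p + p * expR u.
Proof.
move=> p0 p1; set y := expR (p * u).
have y0 : 0 <= y by exact: expR_ge0.
have tangent1 : y * (1 + (1 - p) * u) <= expR u.
  rewrite [leRHS](_ : _ = y * expR ((1 - p) * u)).
    by rewrite ler_wpM2l// expR_ge1Dx.
  by rewrite -expRD; congr expR; ring.
have tangent0 : y * (1 + - (p * u)) <= 1.
  by rewrite -[leRHS](expRxMexpNx_1 (p * u)) ler_wpM2l// expR_ge1Dx.
have := ler_wpM2l p0 tangent1.
have q0 : 0 <= 1 - p by lra.
have := ler_wpM2l q0 tangent0.
by nra.
Qed.

Lemma powR_increment_le (omega : R) (k : nat) :
  0 < omega -> omega < 1 -> (1 <= k)%N ->
  k.+1%:R `^ (1 - omega) / (1 - omega) - k%:R `^ (1 - omega) / (1 - omega) <=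
  1 / k%:R `^ omega.
Proof.
move=> w0 w1 k1; have k0 : (0 : R) < k%:R by rewrite ltr0n.
have k_neq0 : k%:R != 0 :> R by rewrite gt_eqF.
have p0 : 0 < 1 - omega by lra.
have kw0 : 0 < k%:R `^ omega :> R by exact: powR_gt0.
rewrite -mulrBl ler_pdivrMr// mul1r.
have kE : k%:R `^ (1 - omega) = k%:R / k%:R `^ omega :> R.
  by rewrite powRB ?k_neq0 ?implybT// powRr1// ltW.
have k1E : (k.+1%:R : R) = k%:R * (1 + k%:R^-1).
  by rewrite mulrDr mulr1 divff// -natr1.
have h0 : (0 : R) < 1 + k%:R^-1 by rewrite addr_gt0// invr_gt0.
(* Bernoulli's inequality for an exponent in (0,1): the weighted exponential bound at
   [u = ln (1 + k%:R^-1)]. *)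
have bernoulli : (1 + k%:R^-1) `^ (1 - omega) <= 1 + (1 - omega) / k%:R :> R.
  rewrite /powR gt_eqF//.
  have := @expR_weighted_le (1 - omega) (ln (1 + k%:R^-1)) (ltW p0).
  by rewrite lnK ?posrE// => /(_ ltac:(lra)); lra.
rewrite k1E powRM ?(ltW k0) ?(ltW h0)// lerBlDl.
apply: (le_trans (ler_wpM2l (powR_ge0 _ _) bernoulli)).
rewrite mulrDr mulr1 lerD2l kE le_eqVlt; apply/orP; left; apply/eqP.
by field; rewrite k_neq0 gt_eqF.
Qed.

End PowerIncrement.

(** A discrete Gronwall inequality. Nonnegativity of [u] allows [1 - a * l k] to be replaced by
    [expR (- (a * l k))], and these factors multiply to the exponential of a sum. *)
Lemma linear_recursion_bound (R : realType) (a c : R) (l p u : nat -> R) :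
  (forall k, (1 <= k)%N -> 0 <= u k) ->
  (forall k, (1 <= k)%N ->
     u k.+1 <= (1 - a * l k) * u k + c * (l k * p k)) ->
  forall k, u k.+1 <=
    expR (- (a * \sum_(1 <= j < k.+1) l j)) *
    (u 1%N + c * \sum_(1 <= i < k.+1)
       expR (a * \sum_(1 <= j < i.+1) l j) * (l i * p i)).
Proof.
move=> u0 urec.
pose S m := \sum_(1 <= j < m.+1) l j.
pose T m := \sum_(1 <= i < m.+1) expR (a * S i) * (l i * p i).
have SS m : S m.+1 = S m + l m.+1 by rewrite /S big_nat_recr.
have TS m : T m.+1 = T m + expR (a * S m.+1) * (l m.+1 * p m.+1).
  by rewrite /T big_nat_recr.
move=> k; rewrite -/(S k) -/(T k); elim: k => [|k IH].
  by rewrite /S /T !big_geq// !mulr0 oppr0 expR0 mul1r addr0.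
apply: (le_trans (urec k.+1 isT)); rewrite TS (mulrDr c) addrA mulrDr.
(* The old bound absorbs the new decay factor; in the newest noise term the two exponentials
   cancel. *)
set L := l k.+1; apply: lerD.
  have step : (1 - a * L) * u k.+1 <= expR (- (a * L)) * u k.+1.
    by rewrite ler_wpM2r ?u0//; have := expR_ge1Dx (- (a * L)); lra.
  apply: (le_trans step); have := ler_wpM2l (expR_ge0 (- (a * L))) IH.
  by rewrite mulrA -expRD SS (mulrDr a) opprD (addrC (- (a * L))).
by rewrite (mulrCA _ c) (mulrA (expR _) (expR _)) -expRD addNr expR0 mul1r.
Qed.

Theorem corollary2 (R : realType) (V : topologicalLmodType R) (K : set V)
  (hK : closed_convex_cone K) (hKnormal : topologically_normal K)
  (e : V) (he : interior K e)
  (thetastar : V) (nu : R) (hnu0 : 0 < nu) (hnu1 : nu < 1)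
  (H : nat -> V -> V)
  (Hmono : forall k : nat, (1 <= k)%N -> forall x y : V,
     cone_le K x y -> cone_le K (H k x) (H k y))
  (Hcontr : forall k : nat, (1 <= k)%N -> forall x : V,
     gauge_norm K e (H k x - H k thetastar) <=
     nu * gauge_norm K e (x - thetastar))
  (E : nat -> V) (omega : R) (homega0 : 0 < omega) (homega1 : omega < 1)
  (lambda : nat -> R)
  (hlambda : forall k : nat, (1 <= k)%N -> lambda k = 1 / (k%:R `^ omega))
  (theta : nat -> V)
  (htheta : forall k : nat, (1 <= k)%N ->
     theta k.+1 =
     (1 - lambda k) *: theta k + lambda k *: (H k (theta k) + E k))
  (W : nat -> V)
  (hW : forall k : nat, (1 <= k)%N -> W k = H k thetastar - thetastar + E k)
  (P : nat -> V) (hP1 : P 1%N = 0)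
  (hP : forall k : nat, (2 <= k)%N ->
     P k = (1 - lambda k.-1) *: P k.-1 + lambda k.-1 *: W k.-1)
  (k : nat) (hk : (1 <= k)%N) :
  gauge_norm K e (theta k.+1 - thetastar) <=
    expR (- ((1 - nu) / (1 - omega) * (k%:R `^ (1 - omega) - 1)))
      * gauge_norm K e (theta 1%N - thetastar)
    + expR (- ((1 - nu) / (1 - omega) * k%:R `^ (1 - omega)))
      * (\sum_(1 <= l < k.+1)
           expR ((1 - nu) / (1 - omega) * l%:R `^ (1 - omega))
             / (l%:R `^ omega) * gauge_norm K e (P l))
    + gauge_norm K e (P k.+1).
Proof.
have a0 : 0 < 1 - nu by lra.
have p0 : 0 < 1 - omega by lra.
pose N := gauge_norm K e.
pose g (m : nat) : R := m%:R `^ (1 - omega) / (1 - omega).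
have gE m : (1 - nu) / (1 - omega) * m%:R `^ (1 - omega) = (1 - nu) * g m.
  by rewrite /g; ring.
have lam_gt0 m : (1 <= m)%N -> 0 < lambda m.
  by move=> m1; rewrite hlambda// divr_gt0// powR_gt0// ltr0n.
have lam_le1 m : (1 <= m)%N -> lambda m <= 1.
  move=> m1; rewrite hlambda// ler_pdivrMr ?powR_gt0 ?ltr0n// mul1r.
  by rewrite -[leLHS](powRr0 m%:R) ler_powR ?ler1n// ltW.
pose z m := theta m - thetastar - P m.
have zS m : (1 <= m)%N -> z m.+1 =
    (1 - lambda m) *: z m +
    lambda m *: (H m (theta m) - H m thetastar).
  move=> m1; rewrite /z htheta// hP//= hW//.
  (* Splitting [thetastar] with the same weights makes [E m] and [thetastar] cancel inside the
     [lambda m] bracket. *)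
  have {1}-> : thetastar = (1 - lambda m) *: thetastar + lambda m *: thetastar.
    by rewrite -scalerDl subrK scale1r.
  rewrite !opprD (addrACA (_ *: theta m)) (addrACA (_ - _)) -!scalerBr; congr (_ + _ *: _).
  by rewrite opprD addrA opprB addrA subrK addrAC addrK.
have urec m : (1 <= m)%N -> N (z m.+1) <=
    (1 - (1 - nu) * lambda m) * N (z m) + nu * (lambda m * N (P m)).
  move=> m1; rewrite zS//.
  have l0 := lam_gt0 _ m1; have l1 := lam_le1 _ m1.
  have lc0 : 0 <= 1 - lambda m by lra.
  apply: (le_trans (gauge_norm_sublinear hK he _ _ lc0 (ltW l0))).
  (* The contraction controls [theta m - thetastar], which is [z m + P m]; hence the noise
     [nu * (lambda m * N (P m))]. *)
  have tri := gauge_norm_triangle hK he (z m) (P m).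
  rewrite {2}/z subrK in tri.
  have := le_trans (Hcontr _ m1 (theta m)) (ler_wpM2l (ltW hnu0) tri).
  by move=> /(ler_wpM2l (ltW l0)); rewrite /N; lra.
have unrolled := linear_recursion_bound (fun m _ => gauge_norm_ge0 he (z m))
  urec k.
set S := fun m => \sum_(1 <= j < m.+1) lambda j : R.
(* For [m >= 1], [S m - lambda m] is the sum up to [m - 1], so one step changes the quantity by
   [lambda n - (g n.+1 - g n) >= 0]. *)
have T_mono m n : (1 <= m)%N -> (m <= n)%N ->
    S m - lambda m - g m <= S n - lambda n - g n.
  move=> m1; elim: n => [|n IH]; first by rewrite leqn0 => /eqP ->.
  rewrite leq_eqVlt => /predU1P[->//|]; rewrite ltnS => mn.
  have n1 := leq_trans m1 mn.
  apply: (le_trans (IH mn)).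
  have -> : S n.+1 = S n + lambda n.+1 by rewrite /S big_nat_recr.
  have := powR_increment_le homega0 homega1 n1; rewrite -hlambda//.
  by rewrite -/(g n) -/(g n.+1); lra.
have g1 : g 1%N = (1 - omega)^-1 by rewrite /g powR1 mul1r.
have S1 : S 1%N = lambda 1%N by rewrite /S big_nat1.
have z1 : z 1%N = theta 1%N - thetastar by rewrite /z hP1 subr0.
(* Monotonicity loses [lambda m - lambda k <= 1] in the exponent; [nu <= expR (- (1 - nu))] pays for
   it. *)
have S_le m : (1 <= m <= k)%N -> nu * expR ((1 - nu) * (S m - S k)) <=
    expR ((1 - nu) * (g m - g k)).
  move=> /andP[m1 mk]; have := T_mono _ _ m1 mk.
  have := lam_le1 _ m1; have := lam_gt0 _ hk => lk lm Tmk.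
  have nu_exp : nu <= expR (- (1 - nu)).
    by apply: le_trans (expR_ge1Dx _); lra.
  apply: (le_trans (ler_wpM2r (expR_ge0 _) nu_exp)).
  rewrite -expRD ler_expR.
  have : S m - S k <= g m - g k + 1 by lra.
  by move=> /(ler_wpM2l (ltW a0)); lra.
have tri := gauge_norm_triangle hK he (z k.+1) (P k.+1).
rewrite {1}/z subrK in tri; apply: (le_trans tri); rewrite lerD2r.
apply: (le_trans unrolled); rewrite mulrDr -/(S k); apply: lerD.
  (* Starting from index 1, where [S 1 - lambda 1 = 0], gives [S k >= g k - g 1], so the initial
     term gets its exponent without loss. *)
  rewrite z1 ler_wpM2r ?gauge_norm_ge0// ler_expR lerN2.
  rewrite mulrBr gE mulr1.
  have := T_mono _ _ (leqnn 1%N) hk; rewrite S1 g1.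
  have := lam_gt0 _ hk => lk Tk.
  have : g k - (1 - omega)^-1 <= S k by lra.
  by move=> /(ler_wpM2l (ltW a0)); lra.
(* Moving [nu] and the decay factor inside the sum reduces the noise bound to [S_le], term by
   term. *)
rewrite mulrCA [X in nu * X]mulr_sumr [leLHS]mulr_sumr [leRHS]mulr_sumr.
apply: ler_sum_nat => m /andP[m1 mk]; rewrite -/(S m) !gE.
have lP0 : 0 <= lambda m * N (P m).
  by rewrite mulr_ge0 ?gauge_norm_ge0// ltW ?lam_gt0.
have := ler_wpM2r lP0 (S_le m _); rewrite m1 -ltnS mk => /(_ isT).
by rewrite !mulrBr !expRD hlambda// div1r /N; lra.
Qed.
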